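(* Let $k=k_1+k_2$, let $y=(y_1,y_2):\mathbb{R}\times\mathbb{R}^{k_1}\times\mathbb{R}^{k_2}\to\mathbb{R}^{k_1}\times\mathbb{R}^{k_2}$, $(\varepsilon,x)\mapsto y(\varepsilon,x)$ with $x=(x_1,x_2)$, be a $C^2$ function, let $\epsilon>0$ and $E=[0,\epsilon]$. Let $p=(p_1,p_2)\in\mathbb{R}^{k_1}\times\mathbb{R}^{k_2}$ be such that $y(0,p)=0$, let $R>0$ and let $U=B(p,R)$ be the open ball. Assume that $y_2(0,x)=0$ for all $x\in U$. Let $$A_{11}=\frac{\partial y_1}{\partial x_1}(0,p),\qquad A_{22}=\frac{\partial^2 y_2}{\partial\varepsilon\,\partial x_2}(0,p),$$ $$\Delta_1=\left[\frac{\partial y_1}{\partial x}(E,U)-(A_{11},0)\right],\qquad \Delta_2=\left[\frac{\partial^2 y_2}{\partial\varepsilon\,\partial x}(E,U)-(0,A_{22})\right].$$ If $$m(A_{11})R>\epsilon\left\|\frac{\partial y_1}{\partial\varepsilon}(E,p)\right\|+\|\Delta_1\|R,\qquad m(A_{22})R>\left\|\frac{\partial y_2}{\partial\varepsilon}(E,p)\right\|+\|\Delta_2\|R,$$ then for every $\varepsilon\in(0,\epsilon]$ $$\deg\left(y(\varepsilon,\cdot),U,0\right)\neq 0.$$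
   Context: Norms: fix norms on $\mathbb{R}^{k_1}$ and $\mathbb{R}^{k_2}$ and equip $\mathbb{R}^{k}=\mathbb{R}^{k_1}\times\mathbb{R}^{k_2}$ with $\|(x_1,x_2)\|=\max(\|x_1\|,\|x_2\|)$; $B(p,R)$ is the ball in this norm. Matrix norms are the induced operator norms. For a set of vectors or matrices $S$, $\|S\|=\sup_{s\in S}\|s\|$. For a square matrix $A$, $m(A)=1/\|A^{-1}\|$ if $\det A\neq0$ and $m(A)=0$ otherwise. For a function $g$ and sets $E,U$, $g(E,U)=\{g(\varepsilon,x):\varepsilon\in E,x\in U\}$, and $g(E,p)=\{g(\varepsilon,p):\varepsilon\in E\}$. For a set $S$ of vectors or matrices, $[S]$ denotes an interval enclosure of $S$: a product of closed intervals (one for each entry) containing $S$. Here $\frac{\partial y_1}{\partial x}$ and $\frac{\partial^2 y_2}{\partial \varepsilon\partial x}$ are matrices of sizes $k_1\times(k_1+k_2)$ and $k_2\times(k_1+k_2)$; $(A_{11},0)$ and $(0,A_{22})$ are block matrices of these sizes. The cases $k_1=0$ or $k_2=0$ are allowed, in which case the corresponding inequality is omitted. $\deg(f,U,c)$ is the local Brouwer degree of a continuous $f$ in the open set $U$ at $c$, defined when $f^{-1}(c)\cap U$ is compact; the assertion $\deg\neq0$ includes that it is defined. *)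

(* Defs.v *)
(* MathComp / MathComp-Analysis. *)
From HB Require Import structures.
From mathcomp Require Import all_boot all_order all_algebra.
From mathcomp Require Import all_classical all_reals all_analysis.

Set Implicit Arguments.
Unset Strict Implicit.
Unset Printing Implicit Defensive.
Import Order.TTheory GRing.Theory Num.Theory.
Import numFieldNormedType.Exports.
Local Open Scope classical_set_scope.
Local Open Scope ring_scope.

(* The library norm of ['cV[R]_n] is the max norm; it is only used below through
   the topology and the notion of derivative, which do not depend on the norm.
   Arbitrary norms are functions satisfying [is_norm]. *)
Record is_norm (R : realType) (n : nat) (N : 'cV[R]_n -> R) : Prop := IsNorm {
  is_norm_eq0 : forall x, N x = 0 -> x = 0;
  is_normD : forall x y, N (x + y) <= N x + N y;
  is_normZ : forall (a : R) x, N (a *: x) = `|a| * N x }.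

Definition prod_norm (R : realType) (k1 k2 : nat)
    (N1 : 'cV[R]_k1 -> R) (N2 : 'cV[R]_k2 -> R) (x : 'cV[R]_(k1 + k2)) : R :=
  Num.max (N1 (usubmx x)) (N2 (dsubmx x)).

Definition norm_ball (R : realType) (n : nat) (N : 'cV[R]_n -> R)
    (p : 'cV[R]_n) (r : R) : set 'cV[R]_n :=
  [set x | N (x - p) < r].

Definition opnorm (R : realType) (m n : nat)
    (Nn : 'cV[R]_n -> R) (Nm : 'cV[R]_m -> R) (A : 'M[R]_(m, n)) : R :=
  sup [set Nm (A *m x) | x in [set x | Nn x <= 1]].

Definition comin (R : realType) (n : nat) (N : 'cV[R]_n -> R)
    (A : 'M[R]_n) : R :=
  if \det A != 0 then (opnorm N N (invmx A))^-1 else 0.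

(* [sup] is a real supremum, with value 0 on unbounded sets: [set_norm] is meant
   for bounded nonempty sets. *)
Definition set_norm (R : realType) (T : Type) (N : T -> R) (S : set T) : R :=
  sup (N @` S).

Definition interval_enclosure (R : realType) (m n : nat)
    (S D : set 'M[R]_(m, n)) : Prop :=
  S `<=` D /\
  exists lo hi : 'M[R]_(m, n),
    D = [set M | forall i j, lo i j <= M i j <= hi i j].

Definition C1_on (R : realType) (V W : normedModType R) (U : set V)
    (f : V -> W) : Prop :=
  (forall x, U x -> differentiable f x) /\
  (forall v x, U x -> {for x, continuous (fun z => 'D_v f z)}).

Definition C2 (R : realType) (V W : normedModType R) (f : V -> W) : Prop :=
  C1_on setT f /\ forall v, C1_on setT (fun z => 'D_v f z).

(* Jacobian matrix acting on column vectors (the library's [jacobian] acts on row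
   vectors). *)
Definition jacmx (R : realType) (m n : nat) (f : 'cV[R]_n -> 'cV[R]_m)
    (x : 'cV[R]_n) : 'M[R]_(m, n) :=
  \matrix_(i, j) ('D_(delta_mx j 0) f x) i 0.

(* Local Brouwer degree of [f] in [U] at [c]. *)

Definition degree_defined (R : realType) (n : nat) (f : 'cV[R]_n -> 'cV[R]_n)
    (U : set 'cV[R]_n) (c : 'cV[R]_n) : Prop :=
  [/\ open U, {within U, continuous f} & compact (U `&` f @^-1` [set c])].

Definition regular_value (R : realType) (n : nat) (f : 'cV[R]_n -> 'cV[R]_n)
    (U : set 'cV[R]_n) (c : 'cV[R]_n) : Prop :=
  forall x, U x -> f x = c -> \det (jacmx f x) != 0.

(* If [c] is a regular value and [U `&` f @^-1` [set c]] is compact, then this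
   set is finite; the sum is 0 by convention over an infinite support. *)
Definition regular_degree (R : realType) (n : nat) (f : 'cV[R]_n -> 'cV[R]_n)
    (U : set 'cV[R]_n) (c : 'cV[R]_n) : int :=
  \sum_(x \in U `&` f @^-1` [set c]) sgz (\det (jacmx f x)).

(* [g] is a C^1 map with regular value [c] on a relatively compact neighbourhood
   [V] of [U `&` f @^-1` [set c]], close enough to [f] on the boundary of [V] for
   the affine homotopy from [f] to [g] to avoid [c] there. *)
Definition regular_approximation (R : realType) (n : nat)
    (f : 'cV[R]_n -> 'cV[R]_n) (U : set 'cV[R]_n) (c : 'cV[R]_n)
    (V : set 'cV[R]_n) (g : 'cV[R]_n -> 'cV[R]_n) : Prop :=
  [/\ [/\ open V, compact (closure V), closure V `<=` U
        & U `&` f @^-1` [set c] `<=` V],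
      {within closure V, continuous g}, C1_on V g, regular_value g V c
    & forall x, (closure V `\` V) x -> `|g x - f x| < `|f x - c|].

(* The usual definition in stages: the signed count of preimages when [f] is C^1
   and [c] is a regular value, and otherwise the signed count for any regular
   approximation (it does not depend on the approximation). The value is
   meaningful only under [degree_defined f U c]. *)
Definition brouwer_degree (R : realType) (n : nat) (f : 'cV[R]_n -> 'cV[R]_n)
    (U : set 'cV[R]_n) (c : 'cV[R]_n) : int :=
  if `[< C1_on U f /\ regular_value f U c >] then regular_degree f U c
  else xget 0 [set d | exists V g,
    regular_approximation f U c V g /\ d = regular_degree g V c].

(* Main.v *)
(* Put f = (y_1(e,.), y_2(e,.) / e). Since y_2(0,.) vanishes on U, the mean value
   theorem in x and then in the parameter, applied entrywise, gives
   f(x) - f(x') = (diag(A11, A22) + M)(x - x') with the rows of M in the boxes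
   Delta1 and Delta2. Hence G = id - diag(A11, A22)^-1 f contracts the i-th
   component by q_i = |A_ii^-1| |Delta_i| < 1, and the hypotheses say that its
   displacement at p is less than (1 - q_i) r in each component. So y(e,.) has
   exactly one zero in U, the same contraction estimate makes the Jacobian
   invertible throughout U, and the degree is the sign of one nonzero
   determinant. *)
Require Import Defs.
From HB Require Import structures.
From mathcomp Require Import all_boot all_order all_algebra.
From mathcomp Require Import all_classical all_reals all_analysis.
From mathcomp Require Import ring lra.

Set Implicit Arguments.
Unset Strict Implicit.
Unset Printing Implicit Defensive.
Import Order.TTheory GRing.Theory Num.Theory.
Import numFieldNormedType.Exports.
Local Open Scope classical_set_scope.
Local Open Scope ring_scope.

(** * Lipschitz maps and the entrywise max norm *)

Lemma lipschitz_on_open_continuous (R : realType) (V W : normedModType R)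
    (f : V -> W) (U : set V) (x : V) (K : R) : open U -> U x ->
  (forall z, U z -> `|f x - f z| <= K * `|x - z|) -> {for x, continuous f}.
Proof.
move=> oU Ux Kf; apply/cvgrPdist_lt => e e0; near=> z.
apply: (@le_lt_trans _ _ (K * `|x - z|)).
  by apply: Kf; near: z; exact: open_nbhs_nbhs.
(* [K] may be zero or negative, so a positive constant replaces it before dividing. *)
apply: (@le_lt_trans _ _ ((`|K| + 1) * `|x - z|)).
  by rewrite ler_wpM2r// (le_trans (ler_norm _))// lerDl.
rewrite mulrC -ltr_pdivlMr ?ltr_wpDl//.
by near: z; apply: cvgr_dist_lt => //; rewrite divr_gt0// ltr_wpDl.
Unshelve. all: by end_near. Qed.

Lemma mx_entry_norm_le (R : realType) m n (A : 'M[R]_(m, n)) i j :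
  `|A i j| <= `|A|.
Proof.
rewrite [leRHS]/Num.Def.normr/= mx_normrE.
exact: (@le_bigmax _ _ _ _ (fun ij => `|A ij.1 ij.2|) (i, j)).
Qed.

Lemma mx_norm_le (R : realType) m n (A : 'M[R]_(m, n)) a :
  0 <= a -> (forall i j, `|A i j| <= a) -> `|A| <= a.
Proof.
move=> a0 Aa; rewrite [leLHS]/Num.Def.normr/= mx_normrE.
by apply/bigmax_leP; split => // -[i j] _; exact: Aa.
Qed.

(** * Arbitrary norms on column vectors: comparison with the max norm, balls, fixed points *)

Section Norms.
Context {R : realType} {n : nat} {N : 'cV[R]_n -> R}.
Hypothesis N_norm : is_norm N.

Lemma is_norm0 : N 0 = 0.
Proof. by rewrite -(scale0r 0) (is_normZ N_norm) normr0 mul0r. Qed.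

Lemma is_normN x : N (- x) = N x.
Proof. by rewrite -scaleN1r (is_normZ N_norm) normrN1 mul1r. Qed.

Lemma is_norm_ge0 x : 0 <= N x.
Proof.
have := is_normD N_norm x (- x).
by rewrite subrr is_norm0 is_normN -mulr2n pmulrn_lge0.
Qed.

Lemma is_norm_distC x z : N (x - z) = N (z - x).
Proof. by rewrite -is_normN opprB. Qed.

(** Expand [x] in the standard basis: the norms of the basis vectors add up to a valid constant. *)
Lemma is_norm_le_mx_norm : exists2 C, 0 <= C & forall x, N x <= C * `|x|.
Proof.
exists (\sum_i N (delta_mx i 0)) => [|x].
  by apply: sumr_ge0 => i _; exact: is_norm_ge0.
have -> : N x = N (\sum_i x i 0 *: delta_mx i 0).
  by congr N; rewrite [LHS]matrix_sum_delta; apply: eq_bigr => i _; rewrite big_ord1.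
rewrite mulr_suml; elim/big_ind2 : _ => [|u a v b ua vb|i _].
- by rewrite is_norm0.
- exact: le_trans (is_normD N_norm _ _) (lerD ua vb).
- rewrite (is_normZ N_norm) mulrC ler_wpM2l ?is_norm_ge0//.
  exact: mx_entry_norm_le.
Qed.

Lemma is_norm_continuous : continuous N.
Proof.
have [C C0 NC] := is_norm_le_mx_norm.
move=> x; apply: (@lipschitz_on_open_continuous _ _ _ N setT x C) => // [|z _].
  exact: openT.
apply: le_trans (NC _).
rewrite ler_norml; apply/andP; split.
  rewrite lerNl opprB lerBlDr is_norm_distC.
  by rewrite -{1}(subrK x z); exact: is_normD.
by rewrite lerBlDr -{1}(subrK z x); exact: is_normD.
Qed.

(** Heine-Borel for row vectors, carried over by transposition, which is 1-Lipschitz for the max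
    norm in both directions. *)
Lemma bounded_closed_compact_cV (A : set 'cV[R]_n) :
  bounded_set A -> closed A -> compact A.
Proof.
move=> Ab Ac.
have trmx_cont m k : continuous (@trmx R m k).
  move=> M; apply: (@lipschitz_on_open_continuous _ _ _ _ setT M 1) => // [|M' _].
    exact: openT.
  rewrite mul1r -linearB/=; apply: mx_norm_le => // i j.
  by rewrite mxE mx_entry_norm_le.
rewrite (_ : A = trmx @` [set x : 'rV[R]_n | A x^T]); last first.
  apply/seteqP; split => [x Ax|_ [x Ax <-]//].
  by exists x^T => /=; rewrite trmxK.
apply: continuous_compact; first by apply: continuous_subspaceT; exact: trmx_cont.
apply: bounded_closed_compact; last first.
  by apply: (@closed_comp _ _ (@trmx R 1 n)) => // x _; exact: trmx_cont.
case: Ab => M [Mr AM]; exists M; split => // a Ma x /= /(AM _ Ma) /=; apply: le_trans.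
apply: mx_norm_le => // i j.
by have := mx_entry_norm_le x^T j i; rewrite mxE.
Qed.

(** [N] attains a positive minimum on the compact unit sphere of the max norm; the inverse of that
    minimum is the constant, by homogeneity. *)
Lemma mx_norm_le_is_norm : exists2 C, 0 < C & forall x, `|x| <= C * N x.
Proof.
pose S := [set x : 'cV[R]_n | `|x| = 1].
(* An empty sphere leaves only the zero vector (dimension 0), and any constant serves. *)
have [S0|/set0P S0] := eqVneq S set0.
  exists 1 => // x; have [->|x0] := eqVneq x 0.
    by rewrite normr0 mul1r is_norm_ge0.
  suff : S (`|x|^-1 *: x) by rewrite S0.
  by rewrite /S/= normrZ ger0_norm ?invr_ge0// mulVf// normr_eq0.
have cS : compact S.
  apply: bounded_closed_compact_cV.
    by exists 1; split => // a a1 x /= ->; exact: ltW.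
  rewrite /S (_ : [set _ | _] = Num.norm @^-1` [set 1])//.
  by apply: closed_comp => [x _|]; [exact: norm_continuous|exact: closed_eq].
have [c /set_mem Sc minc] := compact_EVT_min S0 cS
  (continuous_subspaceT is_norm_continuous).
have Nc : 0 < N c.
  rewrite lt_neqAle is_norm_ge0 andbT eq_sym; apply/eqP => /(is_norm_eq0 N_norm) c0.
  by move: Sc; rewrite /S/= c0 normr0 => /esym/eqP; rewrite oner_eq0.
exists (N c)^-1 => [|x]; first by rewrite invr_gt0.
have [->|x0] := eqVneq x 0; first by rewrite normr0 is_norm0 mulr0.
rewrite ler_pdivlMl//.
have := minc (`|x|^-1 *: x).
rewrite (is_normZ N_norm) ger0_norm ?invr_ge0// ler_pdivlMl ?normr_gt0// mulrC.
apply; apply/mem_set.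
by rewrite /S/= normrZ ger0_norm ?invr_ge0// mulVf// normr_eq0.
Qed.

Lemma is_norm_dist_continuous (p : 'cV[R]_n) :
  continuous (fun x : 'cV[R]_n => N (x - p)).
Proof.
move=> x; apply: continuous_comp; last exact: is_norm_continuous.
by apply: continuousB => //; exact: cst_continuous.
Qed.

Lemma norm_ball_open p r : open (norm_ball N p r).
Proof.
rewrite /norm_ball (_ : [set _ | _] = (fun x => N (x - p)) @^-1` [set t | t < r])//.
apply: open_comp; last exact: open_lt.
by move=> x _; exact: is_norm_dist_continuous.
Qed.

Lemma compact_closed_norm_ball p r : compact [set x | N (x - p) <= r].
Proof.
apply: bounded_closed_compact_cV.
  have [C C0 NC] := mx_norm_le_is_norm.
  exists (C * r + `|p|); split => [|a a1 x /= xr]; first exact: num_real.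
  apply: le_trans (ltW a1); rewrite -{1}(subrK p x).
  apply: le_trans (ler_normD _ _) _; rewrite lerD2r.
  by apply: le_trans (NC _) _; rewrite ler_pM2l.
rewrite (_ : [set _ | _] = (fun x => N (x - p)) @^-1` [set t | t <= r])//.
apply: closed_comp; last exact: closed_le.
by move=> x _; exact: is_norm_dist_continuous.
Qed.

Lemma norm_ball_convex p r x z t : norm_ball N p r x -> norm_ball N p r z ->
  0 <= t <= 1 -> norm_ball N p r (z + t *: (x - z)).
Proof.
rewrite /norm_ball/= => xr zr /andP[t0 t1].
have -> : z + t *: (x - z) - p = t *: (x - p) + (1 - t) *: (z - p).
  by apply/colP => i; rewrite !mxE; ring.
apply: le_lt_trans (is_normD N_norm _ _) _.
rewrite !(is_normZ N_norm) !ger0_norm ?subr_ge0//.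
(* Strictness comes from the [x] term, which needs [t > 0]; at [t = 0] it comes from [z] alone. *)
have [->|tn0] := eqVneq t 0; first by rewrite mul0r add0r subr0 mul1r.
have : t * N (x - p) < t * r by rewrite ltr_pM2l// lt_neqAle eq_sym tn0.
have : (1 - t) * N (z - p) <= (1 - t) * r by rewrite ler_wpM2l ?subr_ge0// ltW.
by move=> h1 h2; lra.
Qed.

(* A minimiser of the displacement is a fixed point, as applying [G] shrinks the
   displacement. *)
Lemma contraction_fixed_point (G : 'cV[R]_n -> 'cV[R]_n) p r s q :
  0 <= s < r -> q < 1 ->
  (forall x z, norm_ball N p r x -> norm_ball N p r z ->
    N (G x - G z) <= q * N (x - z)) ->
  (forall x, N (x - p) <= s -> N (G x - p) <= s) ->
  exists2 x, norm_ball N p r x & G x = x.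
Proof.
move=> /andP[s0 sr] q1 Gq BG.
pose B := [set x | N (x - p) <= s].
have Bp : B p by rewrite /B/= subrr is_norm0.
have BU x : B x -> norm_ball N p r x by move=> Bx; exact: le_lt_trans Bx sr.
have Gcont : {within B, continuous (fun x => N (G x - x))}.
  apply: (@continuous_in_subspaceT _ _ B) => x /set_mem Bx.
  apply: (@continuous_comp _ _ _ (fun x => G x - x) N); last exact: is_norm_continuous.
  apply: continuousB => //.
  have [C C0 NC] := mx_norm_le_is_norm.
  have [C' C'0 NC'] := is_norm_le_mx_norm.
  (* [G] is 1-Lipschitz for [N]; the two comparison constants turn this into a Lipschitz bound for
     the max norm. *)
  apply: (@lipschitz_on_open_continuous R 'cV[R]_n 'cV[R]_n G
    (norm_ball N p r) x (C * C')) => [||z Uz]; [exact: norm_ball_open|exact: BU|].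
  apply: le_trans (NC _) _; rewrite -mulrA ler_pM2l//.
  apply: le_trans (NC' _); apply: le_trans (Gq _ _ (BU _ Bx) Uz) _.
  by rewrite ler_piMl ?is_norm_ge0// ltW.
have [x /set_mem Bx minx] :=
  compact_EVT_min (ex_intro _ p Bp) (@compact_closed_norm_ball p s) Gcont.
exists x; first exact: BU.
apply/eqP; rewrite -subr_eq0; apply/eqP/(is_norm_eq0 N_norm)/eqP.
rewrite eq_le is_norm_ge0 andbT.
have := minx _ (mem_set (BG _ Bx)).
move=> /le_trans/(_ (Gq _ _ (BU _ (BG _ Bx)) (BU _ Bx))).
by rewrite -subr_ge0 -{2}(mul1r (N _)) -mulrBl nmulr_rge0// subr_lt0.
Qed.

End Norms.

(** * Operator norms and suprema over boxes of matrices *)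

Lemma mulmx_mx_norm_le (R : realType) m n (A : 'M[R]_(m, n)) (x : 'cV[R]_n) :
  `|A *m x| <= n%:R * `|A| * `|x|.
Proof.
apply: mx_norm_le => [|i j]; first by rewrite !mulr_ge0.
rewrite mxE (le_trans (ler_norm_sum _ _ _))//.
rewrite -mulrA mulr_natl -[X in _ *+ X]card_ord -sumr_const.
by apply: ler_sum => k _; rewrite normrM ler_pM// mx_entry_norm_le.
Qed.

Section OperatorNorm.
Context {R : realType} {m n : nat} {Nm : 'cV[R]_m -> R} {Nn : 'cV[R]_n -> R}.
Hypotheses (Nm_norm : is_norm Nm) (Nn_norm : is_norm Nn).

(** The constant is the same for all matrices, so this bounds both the supremum defining one
    operator norm and the operator norms over a whole box. *)
Lemma opnorm_mx_norm_bound :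
  exists2 C, 0 <= C & forall (A : 'M[R]_(m, n)) x, Nn x <= 1 ->
    Nm (A *m x) <= C * `|A|.
Proof.
have [C C0 NC] := is_norm_le_mx_norm Nm_norm.
have [C' C'0 NC'] := mx_norm_le_is_norm Nn_norm.
exists (C * n%:R * C') => [|A x x1]; first by rewrite !mulr_ge0// ltW.
apply: le_trans (NC _) _; rewrite -!mulrA ler_wpM2l//.
apply: le_trans (mulmx_mx_norm_le _ _) _; rewrite -mulrA ler_wpM2l//.
rewrite mulrC ler_wpM2r//; apply: le_trans (NC' _) _.
by rewrite ler_piMr// ltW.
Qed.

Lemma opnorm_has_sup (A : 'M[R]_(m, n)) :
  has_sup [set Nm (A *m x) | x in [set x | Nn x <= 1]].
Proof.
split; first by exists (Nm (A *m 0)), 0 => //=; rewrite is_norm0.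
have [C C0 AC] := opnorm_mx_norm_bound.
by exists (C * `|A|) => _ [x x1 <-]; exact: AC.
Qed.

Lemma opnorm_ge0 (A : 'M[R]_(m, n)) : 0 <= opnorm Nn Nm A.
Proof.
apply: (sup_upper_bound (opnorm_has_sup A)).
by exists 0; rewrite /= ?is_norm0// mulmx0 is_norm0.
Qed.

Lemma opnorm_mulmx_le (A : 'M[R]_(m, n)) x :
  Nm (A *m x) <= opnorm Nn Nm A * Nn x.
Proof.
have [->|x0] := eqVneq x 0; first by rewrite mulmx0 !is_norm0// mulr0.
have Nx : 0 < Nn x.
  rewrite lt_neqAle is_norm_ge0// andbT eq_sym.
  by apply: contra_neq x0; exact: (is_norm_eq0 Nn_norm).
rewrite -ler_pdivrMr// mulrC.
apply: (sup_upper_bound (opnorm_has_sup A)).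
exists ((Nn x)^-1 *: x); last first.
  by rewrite -scalemxAr (is_normZ Nm_norm) ger0_norm// invr_ge0 ltW.
by rewrite /= (is_normZ Nn_norm) ger0_norm ?invr_ge0 ?(ltW Nx)// mulVf ?gt_eqF.
Qed.

(** A box has bounded entries, hence bounded operator norms, so [set_norm] is a genuine supremum
    here and not the default 0. *)
Lemma opnorm_le_set_norm (D : set 'M[R]_(m, n)) (lo hi A : 'M[R]_(m, n)) :
  D = [set M | forall i j, lo i j <= M i j <= hi i j] -> D A ->
  opnorm Nn Nm A <= set_norm (opnorm Nn Nm) D.
Proof.
move=> DE DA; apply: ub_le_sup; last by exists A.
have [C C0 AC] := opnorm_mx_norm_bound.
exists (C * (`|lo| + `|hi|)) => _ [M + <-]; rewrite DE => /= DM.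
apply: ge_sup; first exact: (opnorm_has_sup M).1.
move=> _ [x x1 <-]; apply: le_trans (AC _ _ x1) _; rewrite ler_wpM2l//.
apply: mx_norm_le => [|i j]; first by rewrite addr_ge0.
have /andP[loM hiM] := DM i j.
have := mx_entry_norm_le lo i j; have := mx_entry_norm_le hi i j; rewrite !ler_norml.
move: `|lo| `|hi| (normr_ge0 lo) (normr_ge0 hi) => a b a0 b0.
by move=> /andP[h1 h2] /andP[h3 h4]; apply/andP; split; lra.
Qed.

End OperatorNorm.

(** * From the hypotheses on [comin] to contraction constants *)

Lemma cV0_eq0 (R : realType) (x : 'cV[R]_0) : x = 0.
Proof. by apply/colP; case. Qed.

(** With [a] the operator norm of the inverse of [A] and [S] that of the box, the inequality becomes
    [a * (b + S * r) < r]. Then [q = a * S] is less than 1, and [a * b < (1 - q) * r] is the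
    displacement bound. *)
Lemma comin_contraction (R : realType) (k n : nat) (N1 : 'cV[R]_k -> R)
    (N : 'cV[R]_n -> R) (A : 'M[R]_k) (D : set 'M[R]_(k, n))
    (lo hi : 'M[R]_(k, n)) (b r : R) :
  is_norm N1 -> is_norm N -> 0 < r -> 0 <= b -> D !=set0 ->
  D = [set M | forall i j, lo i j <= M i j <= hi i j] ->
  ((0 < k)%N -> comin N1 A * r > b + set_norm (opnorm N N1) D * r) ->
  A \in unitmx /\ exists q, [/\ 0 <= q < 1,
    forall M, D M -> forall v, N1 (invmx A *m (M *m v)) <= q * N v &
    forall w, N1 w <= b -> N1 (invmx A *m w) < (1 - q) * r].
Proof.
(* In dimension 0 the operator norm of the inverse is 0 and so is [comin]: the inequality would be
   false, hence its guard. All vectors vanish there and [q = 0] works. *)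
move=> n1 nN r0 b0 [M0 DM0] DE; case: k => [|k] in N1 A D lo hi n1 M0 DM0 DE *.
  move=> _; split; first by rewrite unitmxE det_mx00 unitr1.
  exists 0; split => [|M _ v|w _]; first by rewrite lexx ltr01.
    by rewrite (cV0_eq0 (invmx A *m _)) (is_norm0 n1) mul0r.
  by rewrite (cV0_eq0 (invmx A *m _)) (is_norm0 n1) subr0 mul1r.
move=> /(_ isT); set S := set_norm _ _.
have S0 : 0 <= S.
  by apply: le_trans (opnorm_le_set_norm n1 nN DE DM0); exact: opnorm_ge0.
have lhs0 : 0 <= b + S * r by rewrite addr_ge0// mulr_ge0// ltW.
rewrite /comin; case: ifPn => [dA|_]; last by rewrite mul0r ltNge lhs0.
set a := opnorm N1 N1 (invmx A) => ab.
(* Since the inverse of 0 is 0, [a = 0] would make the larger side of the inequality vanish. *)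
have a0 : 0 < a.
  rewrite lt_neqAle opnorm_ge0// andbT; apply/eqP => a0.
  by move: ab; rewrite -a0 invr0 mul0r ltNge lhs0.
have abS : a * (b + S * r) < r.
  by rewrite mulrC -ltr_pdivlMr// [ltRHS]mulrC.
split; first by rewrite unitmxE unitfE.
exists (a * S); split => [|M DM v|w wb].
- rewrite mulr_ge0//= ?(ltW a0)// -(ltr_pM2r r0) mul1r -mulrA.
  by apply: le_lt_trans abS; rewrite ler_pM2l// lerDr.
- apply: le_trans (opnorm_mulmx_le n1 n1 (invmx A) (M *m v)) _.
  rewrite -mulrA ler_pM2l//.
  apply: le_trans (opnorm_mulmx_le n1 nN _ _) _.
  by rewrite ler_wpM2r ?is_norm_ge0// (opnorm_le_set_norm n1 nN DE DM).
- apply: le_lt_trans (opnorm_mulmx_le n1 n1 (invmx A) w) _.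
  apply: (@le_lt_trans _ _ (a * b)); first by rewrite ler_pM2l.
  by move: abS; rewrite mulrDr mulrBl mul1r mulrA; lra.
Qed.

Lemma prod_norm_is_norm (R : realType) (k1 k2 : nat)
    (N1 : 'cV[R]_k1 -> R) (N2 : 'cV[R]_k2 -> R) :
  is_norm N1 -> is_norm N2 -> is_norm (prod_norm N1 N2).
Proof.
move=> n1 n2; split => [x x0|x z|a x].
- have le1 : N1 (usubmx x) <= 0 by rewrite -x0 /prod_norm le_max lexx.
  have le2 : N2 (dsubmx x) <= 0 by rewrite -x0 /prod_norm le_max lexx orbT.
  rewrite -(vsubmxK x) (is_norm_eq0 n1 (x := usubmx x)).
    rewrite (is_norm_eq0 n2 (x := dsubmx x)) ?col_mx0//.
    by apply/eqP; rewrite eq_le le2 is_norm_ge0.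
  by apply/eqP; rewrite eq_le le1 is_norm_ge0.
- rewrite /prod_norm !linearD ge_max; apply/andP; split.
    by apply: le_trans (is_normD n1 _ _) (lerD _ _); rewrite le_max lexx.
  by apply: le_trans (is_normD n2 _ _) (lerD _ _); rewrite le_max lexx orbT.
- by rewrite /prod_norm !linearZ/= (is_normZ n1) (is_normZ n2) maxr_pMr.
Qed.

(** * Directional derivatives and mean value theorems *)

(** [c] maps the line through [a] along [w] to the line through [c a] along [v], so both difference
    quotients are the same function of [h]. This and the next lemma serve for segments and for
    slices of a product. *)
Lemma derivable_affine (R : realType) (V V' W : normedModType R) (f : V -> W)
    (c : V' -> V) (a w : V') (v : V) :
  (forall h : R, c (h *: w + a) = h *: v + c a) ->
  derivable f (c a) v -> derivable (f \o c) a w.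
Proof. by rewrite /derivable => cE; under [in X in _ -> X]eq_fun do rewrite /= cE. Qed.

Lemma derive_affine (R : realType) (V V' W : normedModType R) (f : V -> W)
    (c : V' -> V) (a w : V') (v : V) :
  (forall h : R, c (h *: w + a) = h *: v + c a) ->
  'D_w (f \o c) a = 'D_v f (c a).
Proof. by rewrite /derive => cE; under eq_fun do rewrite /= cE. Qed.

Lemma derive_entry (R : realType) (V : normedModType R) m n
    (f : V -> 'M[R]_(m, n)) (x v : V) i j :
  derivable f x v -> 'D_v (fun z => f z i j) x = 'D_v f x i j.
Proof. by move=> /derive_mx ->; rewrite mxE. Qed.

Lemma derive_jacmx (R : realType) m n (f : 'cV[R]_n -> 'cV[R]_m) x v :
  differentiable f x -> 'D_v f x = jacmx f x *m v.
Proof.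
move=> df; rewrite deriveE//.
rewrite {1}(matrix_sum_delta v) linear_sum; apply/colP => i.
rewrite summxE !mxE; apply: eq_bigr => j _; rewrite big_ord1 linearZ !mxE deriveE//.
by rewrite mulrC.
Qed.

(** The scalar mean value theorem for one entry along the segment from [z] to [x]; the intermediate
    point depends on [i]. *)
Lemma jacmx_mean_value (R : realType) m n (f : 'cV[R]_n -> 'cV[R]_m)
    (U : set 'cV[R]_n) (x z : 'cV[R]_n) :
  (forall u, U u -> differentiable f u) ->
  (forall t, 0 <= t <= 1 -> U (z + t *: (x - z))) ->
  forall i, exists2 u, U u & (f x - f z) i 0 = (jacmx f u *m (x - z)) i 0.
Proof.
move=> df Uxz i; pose c (t : R) : 'cV[R]_n := z + t *: (x - z).
pose g (u : 'cV[R]_n) : R := f u i 0.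
have cE (t h : R) : c (h *: 1 + t) = h *: (x - z) + c t.
  by rewrite /c [h *: 1]mulr1 scalerDl addrCA.
have dg (t : R) : 0 <= t <= 1 -> is_derive t 1 (g \o c) ('D_(x - z) g (c t)).
  move=> t01; split; last exact: derive_affine.
  apply: (@derivable_affine _ _ _ _ _ _ _ _ (x - z)) => //.
  have /derivable_mxP := diff_derivable (v := x - z) (df _ (Uxz _ t01)).
  exact.
have itv t : (t \in `[(0 : R), 1]%R) = (0 <= t <= 1) by rewrite in_itv.
have dg01 (t : R) : t \in `]0, 1[%R -> is_derive t 1 (g \o c) ('D_(x - z) g (c t)).
  by move=> t01; apply: dg; rewrite -itv; exact: subset_itv_oo_cc.
have gc : {within `[0, 1], continuous (g \o c)}.
  apply: (@continuous_in_subspaceT R R `[0, 1]%classic (g \o c)) => t /set_mem/= t01.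
  have [+ _] := dg t (etrans (esym (itv t)) t01).
  by move=> /derivable1_diffP/differentiable_continuous.
have [t] := MVT_segment ler01 dg01 gc.
rewrite itv => t01; rewrite subr0 mulr1 /g /c /= scale1r scale0r addr0 subrKC => E.
exists (c t); first exact: Uxz.
rewrite -derive_jacmx; last exact/df/Uxz.
by rewrite !mxE E derive_entry//; exact/diff_derivable/df/Uxz.
Qed.

(** An entrywise argument would lose the constant for an arbitrary norm. Instead, for a slope [k]
    slightly above [K], the minimum of [N (c t - c 0) - k * t] lies at [e], where the value is
    therefore at most the value 0 at the origin. *)
Lemma mean_value_inequality (R : realType) n (N : 'cV[R]_n -> R) (c : R -> 'cV[R]_n)
    (e K : R) : is_norm N -> 0 <= e ->
  (forall t, 0 <= t <= e -> derivable c t 1) ->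
  (forall t, 0 <= t <= e -> N (derive1 c t) <= K) ->
  N (c e - c 0) <= K * e.
Proof.
move=> nN e0 dc cK; apply/ler_addgt0Pr => d d0.
have e1 : 0 < e + 1 by rewrite ltr_wpDl.
(* This makes [(k - K) * e] at most [d]; the denominator stays positive when [e = 0]. *)
pose k := K + d / (e + 1).
have Kk : K < k by rewrite ltrDl divr_gt0.
pose phi t := N (c t - c 0) - k * t.
have itv t : (t \in `[(0 : R), e]%R) = (0 <= t <= e) by rewrite in_itv.
have phic : {within `[0, e], continuous phi}.
  apply: (@continuous_in_subspaceT R R `[0, e]%classic phi) => t /set_mem/=.
  rewrite itv => t0e; apply: continuousB; last first.
    by apply: continuousM; [exact: cst_continuous|].
  apply: (@continuous_comp _ _ _ c (fun x => N (x - c 0))).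
    exact/differentiable_continuous/derivable1_diffP/dc.
  exact: is_norm_dist_continuous.
have [t] := EVT_min e0 phic.
rewrite itv => t0e mint.
(* From any [t < e] one can step right and decrease [phi], so the minimum is at [e]. *)
have te : t = e.
  apply/eqP; rewrite eq_le (andP t0e).2 leNgt; apply/negP => te.
  (* The norms of the difference quotients tend to a value at most [K], so for a small right step
     they are below [k]. *)
  have qc : (fun h : R => N (h^-1 *: (c (h + t) - c t))) @ 0^' --> N (derive1 c t).
    apply: (@cvg_comp _ _ _ (fun h : R => h^-1 *: (c (h + t) - c t)) N
      _ (nbhs (derive1 c t))).
      have := dc t t0e; rewrite /derivable /derive1.
      suff -> : (fun h : R => h^-1 *: ((c \o shift t) (h *: 1) - c t)) =
                (fun h : R => h^-1 *: (c (h + t) - c t)) by [].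
      by apply/funext => h /=; rewrite [h%:A]mulr1.
    exact: is_norm_continuous.
  have [h [h0 hte Nh]] : exists h : R,
      [/\ 0 < h, h + t <= e & N (h^-1 *: (c (h + t) - c t)) < k].
    near (0 : R)^'+ => h; exists h; split => //.
    - rewrite -lerBrDr ltW//; near: h; apply: nbhs_right_lt.
      by rewrite subr_gt0.
    - near: h.
      have /cvgr_lt : N (h^-1 *: (c (h + t) - c t)) @[h --> 0^'+] --> N (derive1 c t).
        exact: cvg_dnbhs_at_right qc.
      apply; exact: le_lt_trans (cK _ t0e) Kk.
  have : phi (h + t) < phi t.
    rewrite /phi -(subrKA (c t)).
    have : N (c (h + t) - c t) < h * k.
      rewrite -ltr_pdivrMl//; move: Nh.
      by rewrite (is_normZ nN) gtr0_norm ?invr_gt0.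
    have := is_normD nN (c (h + t) - c t) (c t - c 0).
    by lra.
  rewrite ltNge mint// itv hte andbT addr_ge0//; first exact: ltW.
  by case/andP: t0e.
have := mint 0; rewrite itv lexx e0 te => /(_ isT).
rewrite /phi subrr (is_norm0 nN) mulr0 subr0 subr_le0 => /le_trans; apply.
rewrite /k mulrDl lerD2l -mulrA ler_piMr// ?(ltW d0)//.
by rewrite mulrC ler_pdivrMr// mul1r lerDl.
Unshelve. all: by end_near. Qed.

(** * Smoothness of the two block components *)

Lemma usubmx_continuous (R : realType) m1 m2 n :
  continuous (usubmx : 'M[R]_(m1 + m2, n) -> 'M[R]_(m1, n)).
Proof.
move=> M; apply: (@lipschitz_on_open_continuous _ _ _ _ setT M 1) => // [|M' _].
  exact: openT.
rewrite mul1r -linearB/=; apply: mx_norm_le => // i j.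
by rewrite mxE mx_entry_norm_le.
Qed.

Lemma dsubmx_continuous (R : realType) m1 m2 n :
  continuous (dsubmx : 'M[R]_(m1 + m2, n) -> 'M[R]_(m2, n)).
Proof.
move=> M; apply: (@lipschitz_on_open_continuous _ _ _ _ setT M 1) => // [|M' _].
  exact: openT.
rewrite mul1r -linearB/=; apply: mx_norm_le => // i j.
by rewrite mxE mx_entry_norm_le.
Qed.

Lemma derive_linear_comp (R : realType) (V W W' : normedModType R) (f : V -> W)
    (L : {linear W -> W'}) x v :
  continuous L -> differentiable f x -> 'D_v (L \o f) x = L ('D_v f x).
Proof.
move=> cL df; have dL := linear_differentiable (f x) cL.
rewrite (deriveE v (differentiable_comp df dL)) (deriveE v df).
by rewrite (diff_comp df dL) /= (diff_lin (f x) cL).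
Qed.

Lemma C1_linear_comp (R : realType) (V W W' : normedModType R) (f : V -> W)
    (L : {linear W -> W'}) :
  continuous L -> C1_on setT f -> C1_on setT (L \o f).
Proof.
move=> cL [df Df]; split => [x _|v x _].
  by apply: differentiable_comp; [exact: df|exact: linear_differentiable].
rewrite (_ : (fun z => _) = L \o (fun z => 'D_v f z)).
  by apply: continuous_comp; [exact: Df|exact: cL].
by apply/funext => z; rewrite derive_linear_comp//; exact: df.
Qed.

Lemma C2_linear_comp (R : realType) (V W W' : normedModType R) (f : V -> W)
    (L : {linear W -> W'}) :
  continuous L -> C2 f -> C2 (L \o f).
Proof.
move=> cL [C1f C1Df]; split; first exact: C1_linear_comp.
move=> v; rewrite (_ : (fun z => _) = L \o (fun z => 'D_v f z)).
  exact: C1_linear_comp.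
by apply/funext => z; rewrite derive_linear_comp//; exact: C1f.1.
Qed.

(** * Partial and mixed derivatives of a [C2] family of maps *)

Section PartialDerivatives.
Context {R : realType} {m n : nat} {Y : R -> 'cV[R]_n -> 'cV[R]_m}.
Let F (q : R^o * 'cV[R]_n) := Y q.1 q.2.
Hypothesis F_C2 : C2 F.

Let dF q : differentiable F q.
Proof. by have [[+ _] _] := F_C2; apply. Qed.

Let xpair (e : R) (x : 'cV[R]_n) : R^o * 'cV[R]_n := (e, x).
Let tpair (x : 'cV[R]_n) (e : R) : R^o * 'cV[R]_n := (e, x).

Let xpairE e x v (h : R) :
  xpair e (h *: v + x) = h *: ((0, v) : R^o * 'cV[R]_n) + xpair e x.
Proof. by congr pair; rewrite /= scaler0 add0r. Qed.

Let tpairE x e (h : R) :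
  tpair x (h *: 1 + e) = h *: ((1, 0) : R^o * 'cV[R]_n) + tpair x e.
Proof. by congr pair; rewrite /= scaler0 add0r. Qed.

Let xpair_differentiable e x : differentiable (xpair e) x.
Proof. by apply: differentiable_pair; [exact: differentiable_cst|]. Qed.

Let tpair_differentiable x (e : R) : differentiable (tpair x) e.
Proof. by apply: differentiable_pair; [|exact: differentiable_cst]. Qed.

(** Partial derivatives in [x] become directional derivatives of the joint map, to which [F_C2]
    applies. *)
Let derive_slice e x v : 'D_v (Y e) x = 'D_((0, v) : R^o * 'cV[R]_n) F (e, x).
Proof. exact: (derive_affine (c := xpair e) F (xpairE e x v)). Qed.

Lemma C2_slice_differentiable e x : differentiable (Y e) x.
Proof.
apply: (@differentiable_comp _ _ _ _ (xpair e) F).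
  exact: xpair_differentiable.
exact: dF.
Qed.

Lemma C2_slice_C1 e (U : set 'cV[R]_n) : C1_on U (Y e).
Proof.
split => [x _|v x _]; first exact: C2_slice_differentiable.
rewrite (_ : (fun z => _) =
    (fun q => 'D_((0, v) : R^o * 'cV[R]_n) F q) \o xpair e).
  apply: continuous_comp; first exact/differentiable_continuous/xpair_differentiable.
  exact: (F_C2.1.2 _ (e, x) I).
by apply/funext => z; rewrite derive_slice.
Qed.

Lemma C2_param_derivable x (e : R) : derivable (Y^~ x) e 1.
Proof.
apply: (derivable_affine (c := tpair x) (f := F) (v := (1, 0)) (tpairE x e)).
exact: diff_derivable.
Qed.

Lemma C2_param_derive1_continuous x : continuous (derive1 (Y^~ x)).
Proof.
move=> e; rewrite (_ : derive1 _ =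
    (fun q => 'D_((1, 0) : R^o * 'cV[R]_n) F q) \o tpair x).
  apply: continuous_comp; first exact/differentiable_continuous/tpair_differentiable.
  exact: (F_C2.1.2 _ (e, x) I).
apply/funext => t; rewrite derive1E.
exact: (derive_affine (c := tpair x) F (tpairE x t)).
Qed.

(** Column [j] of the Jacobian is the derivative of [F] along [(0, delta_mx j 0)], itself
    differentiable by the second half of [C2]. *)
Lemma C2_jacmx_derivable x (e : R) : derivable (fun t => jacmx (Y t) x) e 1.
Proof.
apply/derivable_mxP => i j.
rewrite (_ : (fun t => _) = (fun t => 'D_(delta_mx j 0) (Y t) x i 0)); last first.
  by apply/funext => t; rewrite mxE.
have : derivable (fun t => 'D_(delta_mx j 0) (Y t) x) e 1.
  rewrite (_ : (fun t => _) =
      (fun q => 'D_((0, delta_mx j 0) : R^o * 'cV[R]_n) F q) \o tpair x).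
    apply: (derivable_affine (c := tpair x) (v := (1, 0))
      (f := fun q => 'D_((0, delta_mx j 0) : R^o * 'cV[R]_n) F q) (tpairE x e)).
    by apply: diff_derivable; exact: (F_C2.2 _).1.
  by apply/funext => t; rewrite derive_slice.
by move/derivable_mxP; exact.
Qed.

(* Differentiating in [x] before [e] matches the order in which the mixed
   derivative is taken, so its symmetry is not needed; the intermediate
   parameters differ from one entry to another, which a box tolerates. *)
Lemma jacmx_param_increment x (e : R) (A0 lo hi : 'M[R]_(m, n)) : 0 < e ->
  (forall t, 0 <= t <= e -> forall i j,
    lo i j <= (derive1 (fun t => jacmx (Y t) x) t - A0) i j <= hi i j) ->
  exists2 M : 'M[R]_(m, n), forall i j, lo i j <= M i j <= hi i j &
    jacmx (Y e) x - jacmx (Y 0) x = e *: (A0 + M).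
Proof.
move=> e0 boxed.
pose J t := jacmx (Y t) x.
have dJ (t : R) i j : is_derive t 1 (fun t => J t i j) (derive1 J t i j).
  split; first by have /derivable_mxP := @C2_jacmx_derivable x t; exact.
  by rewrite derive1E derive_entry//; exact: C2_jacmx_derivable.
have step i j : exists t, 0 <= t <= e /\
    J e i j - J 0 i j = e * derive1 J t i j.
  have Jc : {within `[0, e], continuous (fun t => J t i j)}.
    apply: continuous_subspaceT => t.
    have [+ _] := dJ t i j.
    by move=> /derivable1_diffP/differentiable_continuous.
  have [t] := MVT_segment (ltW e0) (fun t _ => dJ t i j) Jc.
  by rewrite in_itv/= subr0 mulrC => t0e E; exists t.
have /choice[tau tauP] (ij : 'I_m * 'I_n) := step ij.1 ij.2.
exists (\matrix_(i, j) (derive1 J (tau (i, j)) - A0) i j) => [i j|].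
  by rewrite mxE; apply: boxed; exact: (tauP (i, j)).1.
apply/matrixP => i j; have := (tauP (i, j)).2.
by rewrite !mxE /= /J => ->; rewrite addrCA subrr addr0.
Qed.

End PartialDerivatives.

(** The mean value theorem gives a different point, hence a different [M], for each row. Row [i] of
    the [i]-th matrix is kept; the result stays in the box because a box constrains entries
    independently. *)
Lemma jacmx_box_increment (R : realType) m n (g : 'cV[R]_n -> 'cV[R]_m)
    (U : set 'cV[R]_n) (A0 lo hi : 'M[R]_(m, n)) (s : R) (x z : 'cV[R]_n) :
  (forall u, U u -> differentiable g u) ->
  (forall t, 0 <= t <= 1 -> U (z + t *: (x - z))) ->
  (forall u, U u -> exists2 M : 'M[R]_(m, n),
    forall i j, lo i j <= M i j <= hi i j & jacmx g u = s *: (A0 + M)) ->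
  exists2 M : 'M[R]_(m, n), forall i j, lo i j <= M i j <= hi i j &
    g x - g z = s *: ((A0 + M) *m (x - z)).
Proof.
move=> dg Uxz jacU.
have row_step i : exists M : 'M[R]_(m, n),
    (forall i j, lo i j <= M i j <= hi i j) /\
    (g x - g z) i 0 = (s *: ((A0 + M) *m (x - z))) i 0.
  have [u Uu E] := jacmx_mean_value dg Uxz i.
  have [M MD Ju] := jacU u Uu.
  by exists M; split => //; rewrite E Ju scalemxAl.
have /choice[M MP] := row_step.
exists (\matrix_(i, j) M i i j) => [i j|]; first by rewrite mxE; exact: (MP i).1.
apply/colP => i; rewrite (MP i).2 mxE [RHS]mxE; congr (_ * _).
by rewrite !mxE; apply: eq_bigr => j _; rewrite !mxE.
Qed.

(** * Zeros of a map whose increments are close to a block diagonal matrix *)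

Section BlockSystem.
Context {R : realType} {k1 k2 : nat}.
Context {N1 : 'cV[R]_k1 -> R} {N2 : 'cV[R]_k2 -> R}.
Hypotheses (N1_norm : is_norm N1) (N2_norm : is_norm N2).
Local Notation N := (prod_norm N1 N2).
Context {p : 'cV[R]_(k1 + k2)} {r : R} (r_gt0 : 0 < r).
Local Notation U := (norm_ball N p r).
Context {f : 'cV[R]_(k1 + k2) -> 'cV[R]_(k1 + k2)}.
Context {A1 : 'M[R]_k1} {A2 : 'M[R]_k2} {s1 s2 q1 q2 : R}.
Context {D1 : set 'M[R]_(k1, k1 + k2)} {D2 : set 'M[R]_(k2, k1 + k2)}.
Hypotheses (A1_unit : A1 \in unitmx) (A2_unit : A2 \in unitmx).
Hypotheses (s1_neq0 : s1 != 0) (s2_neq0 : s2 != 0).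
Hypotheses (q1_bounds : 0 <= q1 < 1) (q2_bounds : 0 <= q2 < 1).
Hypothesis D1_contraction : forall M, D1 M -> forall v,
  N1 (invmx A1 *m (M *m v)) <= q1 * N v.
Hypothesis D2_contraction : forall M, D2 M -> forall v,
  N2 (invmx A2 *m (M *m v)) <= q2 * N v.

Let N_norm : is_norm N := prod_norm_is_norm N1_norm N2_norm.
Let q := Num.max q1 q2.
Let q_lt1 : q < 1.
Proof. by rewrite gt_max; case/andP: q1_bounds => _ ->; case/andP: q2_bounds. Qed.

(** The inverse of the unperturbed matrix diag([s1 *: A1], [s2 *: A2]). The scales allow the second
    block to be of size [e]. *)
Let L (w : 'cV[R]_(k1 + k2)) : 'cV[R]_(k1 + k2) :=
  col_mx (invmx A1 *m (s1^-1 *: usubmx w)) (invmx A2 *m (s2^-1 *: dsubmx w)).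

(** The common shape of an increment of [f] and of a Jacobian applied to [v]. *)
Let W M1 M2 v : 'cV[R]_(k1 + k2) :=
  col_mx (s1 *: ((row_mx A1 0 + M1) *m v)) (s2 *: ((row_mx 0 A2 + M2) *m v)).

(** The unperturbed part cancels [v], leaving minus the inverse of each block applied to [M1 *m v]
    or [M2 *m v]. The two constants stay separate because each displacement bound uses its own. *)
Let block_residue M1 M2 v : D1 M1 -> D2 M2 ->
  N1 (usubmx (v - L (W M1 M2 v))) <= q1 * N v /\
  N2 (dsubmx (v - L (W M1 M2 v))) <= q2 * N v.
Proof.
move=> D1M D2M; rewrite /L /W col_mxKu col_mxKd !linearB/= col_mxKu col_mxKd.
rewrite !scalerA !mulVf// !scale1r !mulmxDl.
have -> : row_mx A1 0 *m v = A1 *m usubmx v.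
  by rewrite -{1}(vsubmxK v) mul_row_col mul0mx addr0.
have -> : row_mx 0 A2 *m v = A2 *m dsubmx v.
  by rewrite -{1}(vsubmxK v) mul_row_col mul0mx add0r.
rewrite !mulmxDr !mulKmx// !opprD !addrA !subrr !sub0r.
rewrite (is_normN N1_norm) (is_normN N2_norm).
by split; [exact: D1_contraction|exact: D2_contraction].
Qed.

Let residue_le M1 M2 v : D1 M1 -> D2 M2 ->
  N (v - L (W M1 M2 v)) <= q * N v.
Proof.
move=> D1M D2M; have [h1 h2] := block_residue v D1M D2M.
have Nv := is_norm_ge0 N_norm v.
rewrite {1}/prod_norm ge_max; apply/andP; split.
  by apply: le_trans h1 _; rewrite ler_wpM2r// le_max lexx.
by apply: le_trans h2 _; rewrite ler_wpM2r// le_max lexx orbT.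
Qed.

(** If [W M1 M2 v] vanishes, the residue is [v] itself and [N v <= q * N v] with [q < 1]. This gives
    both uniqueness of the zero and invertibility of Jacobians. *)
Lemma block_mulmx_inj M1 M2 v : D1 M1 -> D2 M2 ->
  W M1 M2 v = 0 -> v = 0.
Proof.
move=> D1M D2M w0; have := residue_le v D1M D2M.
rewrite w0 /L !linear0 col_mx0 subr0 => Nvq.
apply: (is_norm_eq0 N_norm); apply/eqP; rewrite eq_le is_norm_ge0// andbT.
move: Nvq; rewrite -subr_ge0 -{2}(mul1r (N v)) -mulrBl.
by rewrite nmulr_rge0// subr_lt0.
Qed.

Hypothesis f_increment : forall x z, U x -> U z ->
  exists M1 M2, [/\ D1 M1, D2 M2 & f x - f z = W M1 M2 (x - z)].
Hypothesis base1 : N1 (invmx A1 *m (s1^-1 *: usubmx (f p))) < (1 - q1) * r.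
Hypothesis base2 : N2 (invmx A2 *m (s2^-1 *: dsubmx (f p))) < (1 - q2) * r.

(** Zeros of [f] are the fixed points of the simplified Newton map [G], since [L] is injective. *)
Lemma block_zero_exists : exists2 x, U x & f x = 0.
Proof.
pose G x := x - L (f x).
have LB x z : L x - L z = L (x - z).
  by rewrite /L opp_col_mx add_col_mx -!mulmxBr -!scalerBr -!linearB.
have GB x z : G x - G z = x - z - L (f x - f z).
  by rewrite -LB /G !opprD !opprK !addrA; congr (_ + _); rewrite addrAC.
have Gp : G p - p = - L (f p) by rewrite /G addrAC subrr sub0r.
have [q1_ge0 q1_lt1] := andP q1_bounds; have [q2_ge0 q2_lt1] := andP q2_bounds.
have q1' : 0 < 1 - q1 by rewrite subr_gt0.
have q2' : 0 < 1 - q2 by rewrite subr_gt0.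
pose b1 := N1 (invmx A1 *m (s1^-1 *: usubmx (f p))).
pose b2 := N2 (invmx A2 *m (s2^-1 *: dsubmx (f p))).
(* The least radius with [q1 * s + b1 <= s] and [q2 * s + b2 <= s]: [G] preserves the closed ball of
   radius [s], and the base bounds say [s < r]. *)
pose s := Num.max (b1 / (1 - q1)) (b2 / (1 - q2)).
have s0 : 0 <= s.
  by rewrite le_max divr_ge0//; [exact: is_norm_ge0|exact: ltW].
have sr : s < r by rewrite gt_max !ltr_pdivrMr// ![r * _]mulrC base1 base2.
have s1P : q1 * s + b1 <= s.
  rewrite -lerBrDl -{1}(mul1r s) -mulrBl mulrC -ler_pdivrMr//.
  by rewrite le_max lexx.
have s2P : q2 * s + b2 <= s.
  rewrite -lerBrDl -{1}(mul1r s) -mulrBl mulrC -ler_pdivrMr//.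
  by rewrite le_max lexx orbT.
have Gq x z : U x -> U z -> N (G x - G z) <= q * N (x - z).
  move=> Ux Uz; have [M1 [M2 [D1M D2M fB]]] := f_increment Ux Uz.
  by rewrite GB fB; exact: residue_le.
have Gs x : N (x - p) <= s -> N (G x - p) <= s.
  move=> xs; have Ux : U x by exact: le_lt_trans xs sr.
  have Up : U p by rewrite /norm_ball/= subrr is_norm0.
  have [M1 [M2 [D1M D2M fB]]] := f_increment Ux Up.
  have [h1 h2] := block_residue (x - p) D1M D2M.
  (* Split [G x - p] into [G x - G p], bounded by the residue, and the displacement [G p - p]. *)
  rewrite -(subrKA (G p)) GB Gp fB /prod_norm [usubmx (_ - L (f p))]linearB.
  rewrite [dsubmx (_ - L (f p))]linearB ge_max; apply/andP; split.
    have Lb : N1 (- usubmx (L (f p))) <= b1 by rewrite is_normN// col_mxKu.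
    apply: le_trans (is_normD N1_norm _ _) (le_trans (lerD h1 Lb) _).
    by apply: le_trans s1P; rewrite lerD2r ler_wpM2l.
  have Lb : N2 (- dsubmx (L (f p))) <= b2 by rewrite is_normN// col_mxKd.
  apply: le_trans (is_normD N2_norm _ _) (le_trans (lerD h2 Lb) _).
  by apply: le_trans s2P; rewrite lerD2r ler_wpM2l.
have s0r : 0 <= s < r by rewrite s0.
have [x Ux Gx] := contraction_fixed_point N_norm s0r q_lt1 Gq Gs.
exists x => //; have : L (f x) = 0.
  by apply/eqP; rewrite -oppr_eq0; move/eqP: Gx; rewrite /G -subr_eq0 addrAC subrr sub0r.
rewrite /L -col_mx0 => /eq_col_mx[E1 E2].
have solve k (A : 'M[R]_k) c w : A \in unitmx -> c != 0 ->
    invmx A *m (c^-1 *: w) = 0 :> 'cV_k -> w = 0.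
  move=> uA c0 /(congr1 (mulmx A)); rewrite mulKVmx// mulmx0 => /eqP.
  by rewrite scaler_eq0 invr_eq0 (negPf c0) => /eqP.
by rewrite -(vsubmxK (f x)) (solve _ _ _ _ A1_unit s1_neq0 E1)
           (solve _ _ _ _ A2_unit s2_neq0 E2) col_mx0.
Qed.

Lemma block_zero_unique x z : U x -> U z -> f x = f z -> x = z.
Proof.
move=> Ux Uz fxz; have [M1 [M2 [D1M D2M fB]]] := f_increment Ux Uz.
apply/eqP; rewrite -subr_eq0; apply/eqP/(block_mulmx_inj D1M D2M).
by rewrite -fB fxz subrr.
Qed.

End BlockSystem.

(** * The degree at a regular value with one preimage, and the final assembly *)

(** The fibre is a singleton, hence compact, and the regular branch of the definition reduces to the
    sign of one nonzero determinant. *)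
Lemma brouwer_degree_unique_preimage (R : realType) n (f : 'cV[R]_n -> 'cV[R]_n)
    (U : set 'cV[R]_n) (c x : 'cV[R]_n) :
  open U -> C1_on U f -> regular_value f U c ->
  U x -> f x = c -> (forall z, U z -> f z = c -> z = x) ->
  degree_defined f U c /\ brouwer_degree f U c != 0.
Proof.
move=> oU C1f reg Ux fx uniq_x.
have fiberE : U `&` f @^-1` [set c] = [set x].
  by apply/seteqP; split => [z [Uz /= fz]|_ ->//]; exact: uniq_x.
split; first split => //.
- apply: (@continuous_in_subspaceT _ _ U) => z /set_mem Uz.
  exact/differentiable_continuous/(C1f.1 z Uz).
- by rewrite fiberE; exact: compact_set1.
rewrite /brouwer_degree asboolT// /regular_degree fiberE fsbig_set1 sgz_eq0.
exact: reg.
Qed.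

(** Compactness of the segment bounds the norms, so that [set_norm] does not fall back on its
    default 0. *)
Lemma le_set_norm_segment (R : realType) n (N : 'cV[R]_n -> R) (c : R -> 'cV[R]_n)
    (e t : R) : is_norm N -> continuous c -> 0 <= t <= e ->
  N (c t) <= set_norm N [set c u | u in [set u : R | 0 <= u <= e]].
Proof.
move=> nN cc te; apply: ub_le_sup; last by exists (c t) => //; exists t.
have e0 : 0 <= e by case/andP: te => /le_trans h /h.
have Ncc : {within `[0, e], continuous (fun u => - N (c u))}.
  apply: continuous_subspaceT => u; apply: continuousN.
  exact: (continuous_comp (cc u) (is_norm_continuous nN (x := c u))).
have [m _ maxm] := EVT_min e0 Ncc.
exists (N (c m)) => _ [_ [u /= ue <-] <-].
by rewrite -lerN2; apply: maxm; rewrite in_itv.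
Qed.

Lemma jacmx_col_mx (R : realType) k1 k2 n (f : 'cV[R]_n -> 'cV[R]_(k1 + k2)) x :
  differentiable f x ->
  jacmx f x = col_mx (jacmx (usubmx \o f) x) (jacmx (dsubmx \o f) x).
Proof.
move=> df; rewrite -[LHS]vsubmxK; congr col_mx; apply/matrixP => i j; rewrite !mxE.
  by rewrite (derive_linear_comp _ (@usubmx_continuous R k1 k2 1)) ?mxE.
by rewrite (derive_linear_comp _ (@dsubmx_continuous R k1 k2 1)) ?mxE.
Qed.

Theorem lemma5 (R : realType) (k1 k2 : nat)
    (N1 : 'cV[R]_k1 -> R) (N2 : 'cV[R]_k2 -> R)
    (N1_norm : is_norm N1) (N2_norm : is_norm N2)
    (y : R -> 'cV[R]_(k1 + k2) -> 'cV[R]_(k1 + k2))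
    (y_C2 : C2 (fun q : R^o * 'cV[R]_(k1 + k2) => y q.1 q.2))
    (eps : R) (eps_gt0 : 0 < eps)
    (p : 'cV[R]_(k1 + k2)) (y0p : y 0 p = 0)
    (r : R) (r_gt0 : 0 < r)
    (Delta1 : set 'M[R]_(k1, k1 + k2)) (Delta2 : set 'M[R]_(k2, k1 + k2)) :
  let N := prod_norm N1 N2 in
  let E := [set e : R | 0 <= e <= eps] in
  let U := norm_ball N p r in
  let y1 := fun e x => usubmx (y e x) in
  let y2 := fun e x => dsubmx (y e x) in
  let dy1_dx := fun e x => jacmx (y1 e) x in
  let d2y2_dedx := fun e x => derive1 (fun t : R => jacmx (y2 t) x) e in
  let dy1_de := fun e x => derive1 (fun t : R => y1 t x) e in
  let dy2_de := fun e x => derive1 (fun t : R => y2 t x) e in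
  let A11 : 'M[R]_k1 := lsubmx (dy1_dx 0 p) in
  let A22 : 'M[R]_k2 := rsubmx (d2y2_dedx 0 p) in
  (forall x, U x -> y2 0 x = 0) ->
  interval_enclosure
    [set M | exists e x, [/\ E e, U x & M = dy1_dx e x - row_mx A11 0]]
    Delta1 ->
  interval_enclosure
    [set M | exists e x, [/\ E e, U x & M = d2y2_dedx e x - row_mx 0 A22]]
    Delta2 ->
  ((0 < k1)%N ->
    comin N1 A11 * r > eps * set_norm N1 [set dy1_de e p | e in E]
                       + set_norm (opnorm N N1) Delta1 * r) ->
  ((0 < k2)%N ->
    comin N2 A22 * r > set_norm N2 [set dy2_de e p | e in E]
                       + set_norm (opnorm N N2) Delta2 * r) ->
  forall e : R, 0 < e <= eps ->
    degree_defined (y e) U 0 /\ brouwer_degree (y e) U 0 != 0.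
Proof.
move=> N E U y1 y2 dy1_dx d2y2_dedx dy1_de dy2_de A11 A22 y20.
move=> [S1 [lo1 [hi1 D1E]]] [S2 [lo2 [hi2 D2E]]] H1 H2 e /andP[e_gt0 e_le].
have N_norm : is_norm N := prod_norm_is_norm N1_norm N2_norm.
have y1_C2 : C2 (fun q : R^o * 'cV[R]_(k1 + k2) => y1 q.1 q.2).
  exact: (C2_linear_comp (@usubmx_continuous R k1 k2 1) y_C2).
have y2_C2 : C2 (fun q : R^o * 'cV[R]_(k1 + k2) => y2 q.1 q.2).
  exact: (C2_linear_comp (@dsubmx_continuous R k1 k2 1) y_C2).
have E0 : E 0 by rewrite /E/= lexx ltW.
have Up : U p by rewrite /U /norm_ball/= subrr (is_norm0 N_norm).
have E_le t : 0 <= t <= e -> E t.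
  by move=> /andP[t0 te]; rewrite /E/= t0 (le_trans te).
have D1n0 : Delta1 !=set0.
  by exists (dy1_dx 0 p - row_mx A11 0); apply: S1; exists 0, p.
have D2n0 : Delta2 !=set0.
  by exists (d2y2_dedx 0 p - row_mx 0 A22); apply: S2; exists 0, p.
set s1 := set_norm N1 _ in H1; set s2 := set_norm N2 _ in H2.
have de1_le t : E t -> N1 (dy1_de t p) <= s1.
  move=> Et; apply: (@le_set_norm_segment _ _ N1 (dy1_de^~ p)) => //.
  exact: (C2_param_derive1_continuous y1_C2).
have de2_le t : E t -> N2 (dy2_de t p) <= s2.
  move=> Et; apply: (@le_set_norm_segment _ _ N2 (dy2_de^~ p)) => //.
  exact: (C2_param_derive1_continuous y2_C2).
have s1_ge0 : 0 <= s1 by apply: le_trans (de1_le _ E0); exact: is_norm_ge0.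
have s2_ge0 : 0 <= s2 by apply: le_trans (de2_le _ E0); exact: is_norm_ge0.
have [uA1 [q1 [q1_bounds D1q base1]]] := comin_contraction N1_norm N_norm r_gt0
  (mulr_ge0 (ltW eps_gt0) s1_ge0) D1n0 D1E H1.
have [uA2 [q2 [q2_bounds D2q base2]]] := comin_contraction N2_norm N_norm r_gt0
  s2_ge0 D2n0 D2E H2.
have y1p : N1 (y1 e p) <= s1 * e.
  rewrite -[y1 e p]subr0 (_ : 0 = y1 0 p); last by rewrite /y1 y0p linear0.
  apply: (mean_value_inequality (c := y1^~ p) N1_norm (ltW e_gt0)) => t te.
    exact: (C2_param_derivable y1_C2).
  exact/de1_le/E_le.
have y2p : N2 (y2 e p) <= s2 * e.
  rewrite -[y2 e p]subr0 (_ : 0 = y2 0 p); last by rewrite y20.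
  apply: (mean_value_inequality (c := y2^~ p) N2_norm (ltW e_gt0)) => t te.
    exact: (C2_param_derivable y2_C2).
  exact/de2_le/E_le.
have oU : open U by exact: norm_ball_open.
have jac1 u : U u -> exists2 M : 'M[R]_(k1, k1 + k2),
    forall i j, lo1 i j <= M i j <= hi1 i j & jacmx (y1 e) u = 1 *: (row_mx A11 0 + M).
  move=> Uu; exists (dy1_dx e u - row_mx A11 0); last first.
    by rewrite scale1r addrCA subrr addr0.
  have : Delta1 (dy1_dx e u - row_mx A11 0).
    by apply: S1; exists e, u; split => //; rewrite /E/= ltW.
  by rewrite D1E.
(* [y2 0] vanishes on the open set [U], so near [u] it agrees with the constant 0. *)
have jac20 u : U u -> jacmx (y2 0) u = 0.
  move=> Uu; apply/matrixP => i j; rewrite !mxE.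
  rewrite (@near_eq_derive _ _ _ _ (cst 0)) ?derive_cst ?mxE//.
  by apply: filterS (open_nbhs_nbhs (conj oU Uu)) => z /y20.
(* As the Jacobian of [y2] starts from 0 at parameter 0, its increment is the whole Jacobian; this
   produces the factor [e]. *)
have jac2 u : U u -> exists2 M : 'M[R]_(k2, k1 + k2),
    forall i j, lo2 i j <= M i j <= hi2 i j & jacmx (y2 e) u = e *: (row_mx 0 A22 + M).
  move=> Uu; rewrite -[jacmx (y2 e) u]subr0 -(jac20 u Uu).
  apply: (jacmx_param_increment y2_C2) => // t te.
  have : Delta2 (d2y2_dedx t u - row_mx 0 A22).
    by apply: S2; exists t, u; split => //; exact: E_le.
  by rewrite D2E.
have incr x z : U x -> U z -> exists M1 M2, [/\ Delta1 M1, Delta2 M2 & y e x - y e z =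
    col_mx (1 *: ((row_mx A11 0 + M1) *m (x - z)))
      (e *: ((row_mx 0 A22 + M2) *m (x - z)))].
  move=> Ux Uz; have seg t : 0 <= t <= 1 -> U (z + t *: (x - z)).
    exact: (norm_ball_convex N_norm).
  have [M1 M1D E1] := jacmx_box_increment
    (fun u _ => C2_slice_differentiable y1_C2 e u) seg jac1.
  have [M2 M2D E2] := jacmx_box_increment
    (fun u _ => C2_slice_differentiable y2_C2 e u) seg jac2.
  exists M1, M2; rewrite D1E D2E; split => //.
  by rewrite -E1 -E2 /y1 /y2 -!linearB/= vsubmxK.
have eN0 : e != 0 by rewrite gt_eqF.
have inj_mx := block_mulmx_inj N1_norm N2_norm uA1 uA2 (oner_neq0 R) eN0
  q1_bounds q2_bounds D1q D2q.
have b1p : N1 (invmx A11 *m (1^-1 *: y1 e p)) < (1 - q1) * r.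
  apply: base1; rewrite invr1 scale1r; apply: le_trans y1p _.
  by rewrite mulrC ler_wpM2r.
(* Dividing by [e] cancels the factor in [y2p], which is why [eps] is absent from the second
   inequality. *)
have b2p : N2 (invmx A22 *m (e^-1 *: y2 e p)) < (1 - q2) * r.
  apply: base2; rewrite (is_normZ N2_norm) ger0_norm ?invr_ge0 ?(ltW e_gt0)//.
  by rewrite ler_pdivrMl// mulrC.
have [x Ux yx] := block_zero_exists N1_norm N2_norm r_gt0 uA1 uA2 (oner_neq0 R) eN0
  q1_bounds q2_bounds D1q D2q incr b1p b2p.
apply: (brouwer_degree_unique_preimage oU _ _ Ux yx) => [|u Uu _|z Uz yz].
- exact: (C2_slice_C1 y_C2).
(* A singular Jacobian would kill a nonzero vector. [det0P] speaks of row vectors, hence the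
   transposes; the Jacobian at [u] has the shape [W], so [inj_mx] applies. *)
- rewrite -det_tr; apply/det0P => -[v v0].
  move=> /(congr1 trmx); rewrite trmx_mul trmxK trmx0.
  rewrite jacmx_col_mx; last exact: (C2_slice_differentiable y_C2).
  have [M1 M1D ->] := jac1 u Uu; have [M2 M2D ->] := jac2 u Uu.
  rewrite mul_col_mx -!scalemxAl => /inj_mx v0'.
  move/eqP: v0; apply; apply: trmx_inj; rewrite trmx0.
  by apply: v0'; rewrite ?D1E ?D2E.
- apply: (block_zero_unique N1_norm N2_norm uA1 uA2 (oner_neq0 R) eN0
    q1_bounds q2_bounds D1q D2q incr) => //.
  by rewrite yx yz.
Qed.
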